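(* Let $n\ge 1$ and let $M \in \mathbb{C}^{2n \times 2n}$ be normal and per-Hermitian. Then there exist a unitary and perplectic matrix $U \in \mathbb{C}^{2n \times 2n}$, nonnegative integers $c, r$ with $c + r = n$, a diagonal matrix $D \in \mathbb{C}^{c\times c}$ all of whose diagonal entries have nonzero imaginary part, and a matrix $X\in\mathbb{R}^{2r\times 2r}$ such that $$U^H M U = \begin{bmatrix} D & & \\ & X & \\ & & F_c D^H F_c \end{bmatrix}$$ (block diagonal), this matrix is per-Hermitian, and $X$ is a real matrix of the form $$X = \begin{bmatrix} a_1 & & & & & b_1\\ & \ddots & & & \cdot^{\cdot^{\cdot}} & \\ & & a_r & b_r & & \\ & & b_r & a_r & & \\ & \cdot^{\cdot^{\cdot}} & & & \ddots & \\ b_1 & & & & & a_1\end{bmatrix}$$ with $a_1,\dots,a_r,b_1,\dots,b_r\in\mathbb{R}$; that is, $X_{jj} = X_{2r+1-j,\,2r+1-j} = a_j$ and $X_{j,\,2r+1-j} = X_{2r+1-j,\,j} = b_j$ for $j=1,\dots,r$, and all other entries of $X$ are zero. Moreover, $X$ is symmetric as well as per-symmetric; in particular, all eigenvalues of $X$ are real.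
   Context: $X^H$ denotes the conjugate transpose and $X^T$ the transpose of $X$. For $m \ge 1$, $F_m\in\mathbb{R}^{m\times m}$ denotes the flip (exchange) matrix with ones on the antidiagonal and zeros elsewhere, i.e. $(F_m)_{ij}=1$ if $i+j=m+1$ and $0$ otherwise. A matrix $M\in\mathbb{C}^{2n\times 2n}$ is per-Hermitian if $(F_{2n}M)^H = F_{2n}M$. A matrix $P\in\mathbb{C}^{2n\times 2n}$ is perplectic if $P^H F_{2n} P = F_{2n}$. A matrix $X\in\mathbb{R}^{2r\times 2r}$ is per-symmetric if $(F_{2r}X)^T = F_{2r}X$. A matrix is normal if $XX^H=X^HX$ and unitary if $X^HX=XX^H=I$. Blocks of size zero (i.e. $c=0$ or $r=0$) are allowed and are then absent. *)

(* Defs.v *)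
From mathcomp Require Import all_boot all_order all_algebra.
From mathcomp Require Import sesquilinear spectral complex reals.

Set Implicit Arguments.
Unset Strict Implicit.
Unset Printing Implicit Defensive.

Import GRing.Theory Num.Theory.
Local Open Scope ring_scope.
Local Open Scope sesquilinear_scope.
Local Open Scope complex_scope.

(* The condition i + j = m + 1 on 1-based indices is (i + j).+1 = m on the
   0-based indices of 'I_m. *)
Definition flipmx (R : pzSemiRingType) (m : nat) : 'M[R]_m :=
  \matrix_(i < m, j < m) ((i + j).+1 == m)%:R.

Definition perhermitian (C : numClosedFieldType) (m : nat) (M : 'M[C]_m) : Prop :=
  (flipmx C m *m M)^t* = flipmx C m *m M.

Definition perplectic (C : numClosedFieldType) (m : nat) (P : 'M[C]_m) : Prop :=
  P^t* *m flipmx C m *m P = flipmx C m.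

Definition persymmetric (R : pzSemiRingType) (m : nat) (X : 'M[R]_m) : Prop :=
  (flipmx R m *m X)^T = flipmx R m *m X.

Definition complexmx (R : realType) (m n : nat) (X : 'M[R]_(m, n)) : 'M[R[i]]_(m, n) :=
  map_mx (real_complex R) X.

Definition fst_half (r : nat) (j : 'I_r) : 'I_(2 * r) :=
  widen_ord (leq_pmull r (ltn0Sn 1)) j.

(* [rev_ord] is j |-> 2r + 1 - j on 1-based indices. *)
Definition is_crossmx (R : realType) (r : nat) (a b : 'I_r -> R)
    (X : 'M[R]_(2 * r)) : Prop :=
  (forall j : 'I_r,
     let p := fst_half j in let q := rev_ord p in
     [/\ X p p = a j, X q q = a j, X p q = b j & X q p = b j]) /\
  (forall i k : 'I_(2 * r), k != i -> k != rev_ord i -> X i k = 0).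

Lemma canon_dim (c r n : nat) : (c + r = n -> c + (2 * r + c) = 2 * n)%N.
Proof. by move=> <-; rewrite [(2 * r + c)%N]addnC addnA addnn -mul2n -mulnDr. Qed.

Definition canonmx (C : numClosedFieldType) (c r n : nat) (e : (c + r = n)%N)
    (D : 'M[C]_c) (X : 'M[C]_(2 * r)) : 'M[C]_(2 * n) :=
  castmx (canon_dim e, canon_dim e)
    (block_mx D 0
              0 (block_mx X 0
                          0 (flipmx C c *m D^t* *m flipmx C c))).

(* Main.v *)
Require Import Defs.
From mathcomp Require Import all_boot all_order all_algebra.
From mathcomp Require Import zify ring.
From mathcomp Require Import sesquilinear spectral complex reals.

Set Implicit Arguments.
Unset Strict Implicit.
Unset Printing Implicit Defensive.

Import Order.TTheory GRing.Theory Num.Theory.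
Local Open Scope ring_scope.
Local Open Scope sesquilinear_scope.
Local Open Scope complex_scope.

(** Let F be the flip matrix. In an orthonormal basis of the (+1)- and
    (-1)-eigenspaces of F, both of dimension n, a normal per-Hermitian M becomes
    [[A, B], [-B^H, D]] with A, D Hermitian, and normality says A B = B D. Hence
    there are unitary P, Q making P A P^H, Q D Q^H and P B Q^H diagonal at once,
    say with real diagonals a, d, b. Each index j yields an M-invariant plane
    with orthonormal basis x, y such that F x = x and F y = -y. If b_j != 0, then
    a_j = d_j and (x + 'i y) / sqrt 2 is an eigenvector for a non-real eigenvalue,
    exchanged by F with one for the conjugate eigenvalue; if b_j = 0, the pair
    (x +- y) / sqrt 2 is exchanged by F and yields a 2 x 2 real cross block. *)

(** * Simultaneous unitary diagonalization of [A], [B] and [D] when [A B = B D] *)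

Section CommutingSVD.
Variable C : numClosedFieldType.

Lemma trmxC_mul m n p (A : 'M[C]_(m, n)) (B : 'M[C]_(n, p)) :
  (A *m B)^t* = B^t* *m A^t*.
Proof. by rewrite trmx_mul map_mxM. Qed.

Lemma trmxCD m n (A B : 'M[C]_(m, n)) : (A + B)^t* = A^t* + B^t*.
Proof. by rewrite linearD map_mxD. Qed.

Lemma trmxCN m n (A : 'M[C]_(m, n)) : (- A)^t* = - A^t*.
Proof. by rewrite linearN map_mxN. Qed.

Lemma trmxCZ m n k (A : 'M[C]_(m, n)) : (k *: A)^t* = k^*%R *: A^t*.
Proof. by rewrite linearZ map_mxZ. Qed.

(** A diagonal entry of [A *m A^t*] is the sum of the squared moduli of a row of [A], so it vanishes
    only with that row. *)
Lemma mulmxC_eq0 m n (A : 'M[C]_(m, n)) : (A *m A^t* == 0) = (A == 0).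
Proof.
apply/eqP/eqP => [AA0|->]; last by rewrite mul0mx.
apply/matrixP => i k; rewrite mxE; apply/eqP; rewrite -mul_conjC_eq0; apply/eqP.
have := congr1 (fun B : 'M_m => B i i) AA0; rewrite !mxE => /psumr_eq0P.
by move/(_ _ k isT)=> <- => [|j _]; rewrite !mxE ?mul_conjC_ge0.
Qed.

(** The restrictions of [A] and [B] to the row space of [V] still commute; a common eigenvector of
    these is carried back by the row basis. *)
Lemma common_eigenvector_sub n (V A B : 'M[C]_n) :
  V != 0 -> A *m B = B *m A -> stablemx V A -> stablemx V B ->
  exists2 v : 'rV_n, v != 0 & [&& (v <= V)%MS, stablemx v A & stablemx v B].
Proof.
move=> V_neq0 AB_comm VA VB.
have [||v v_neq0 /andP[vA vB]] :=
  @common_eigenvector2 _ _ (restrictmx V A) (restrictmx V B).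
- by rewrite lt0n mxrank_eq0.
- by rewrite -!conjmxM ?inE ?stablemx_row_base // AB_comm.
exists (v *m row_base V); first by rewrite mulmx_free_eq0 ?row_base_free.
rewrite (stablemx_restrict _ VA) in vA; rewrite (stablemx_restrict _ VB) in vB.
by apply/and3P; split=> //; rewrite mulmx_sub ?eq_row_base.
Qed.

Lemma normalize_row n (u : 'rV[C]_n) : u != 0 ->
  exists2 k : C, 0 < k & (k *: u) \is unitarymx.
Proof.
move=> u_neq0; have u_gt0 : 0 < (u *m u^t*) 0 0.
  by rewrite -dotmxE; apply: dotmx_is_dotmx.
exists (sqrtC ((u *m u^t*) 0 0))^-1; first by rewrite invr_gt0 sqrtC_gt0.
apply/unitarymxP; rewrite trmxCZ -scalemxAl -scalemxAr scalerA.
rewrite (CrealP _) ?ger0_real ?invr_ge0 ?sqrtC_ge0 ?ltW //.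
rewrite -invfM -expr2 sqrtCK {2}[u *m _]mx11_scalar scale_scalar_mx.
by rewrite mulVf ?gt_eqF.
Qed.

(** The orthogonal complement of [p] has dimension [n]; Gram-Schmidt is applied to a basis of it. *)
Lemma unitarymx_complete_row n (p : 'rV[C]_(1 + n)) : p \is unitarymx ->
  exists2 W : 'M_(n, 1 + n), W \is unitarymx & W *m p^t* = 0.
Proof.
move=> p_unitary; set V := orthomx Num.conj (mx_of_hermitian (hermitian1mx _)) p.
have rV : \rank V = n by rewrite rank_ortho mxrank_unitary // addKn.
have: row_base V *m p^t* = 0 by apply/orthomx1P; rewrite eq_row_base.
have := row_base_free V; move: (row_base V); rewrite rV => B B_free Bp.
exists (schmidt B); first by rewrite schmidt_unitarymx // leq_addl.
by apply/orthomx1P; rewrite eqmx_schmidt_free //; apply/orthomx1P.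
Qed.

Lemma hermitian_diagonalization n (A : 'M[C]_n) : A^t* = A ->
  exists P : 'M_n, exists a : 'rV_n,
    P \is unitarymx /\ P *m A *m P^t* = diag_mx a.
Proof.
move=> A_herm; have /orthomx_spectralP A_eq : A \is normalmx.
  by apply/normalmxP; rewrite A_herm.
have Pu := spectral_unitarymx A.
exists (spectralmx A), (spectral_diag A); split=> //.
by rewrite {2}A_eq invmx_unitary // !mulmxA mulmxtVK // (unitarymxP Pu) mul1mx.
Qed.

Lemma stable_rowP n (v : 'rV[C]_n) (A : 'M_n) :
  stablemx v A -> exists k, v *m A = k *: v.
Proof. by move=> /sub_rVP. Qed.

Lemma trmxC_eqN0 m n (A : 'M[C]_(m, n)) : (A^t* != 0) = (A != 0).
Proof. by rewrite map_mx_eq0 trmx_eq0. Qed.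

(** A pair of singular vectors of [B] that are also eigenvectors of [A] and [D]. Taking adjoints in
    [A B = B D] gives [B^t* A = D B^t*], so [A] commutes with [B B^t*]. A common eigenvector of
    these two is [p], and [q] is [p *m B] normalized. *)
Lemma singular_pair n (A B D : 'M[C]_n) :
  A^t* = A -> D^t* = D -> A *m B = B *m D -> B != 0 ->
  exists p q : 'rV_n, exists a b d : C,
    [/\ p \is unitarymx, q \is unitarymx & 0 < b] /\
    [/\ p *m A = a *: p, q *m D = d *: q, p *m B = b *: q
      & q *m B^t* = b *: p].
Proof.
move=> A_herm D_herm AB B_neq0.
have BA : B^t* *m A = D *m B^t*.
  by rewrite -[A in LHS]A_herm -trmxC_mul AB trmxC_mul D_herm.
(* A common eigenvector in the row space of [B^t*] is not killed by [B]. *)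
have [||||p' p'_neq0 /and3P[p'B /stable_rowP[a p'A] /stable_rowP[s p'S]]] :=
  @common_eigenvector_sub _ (B^t*) A (B *m B^t*).
- by rewrite trmxC_eqN0.
- by rewrite mulmxA AB -!mulmxA BA.
- by rewrite BA; apply: submxMl.
- by rewrite mulmxA; apply: submxMl.
have p'B_neq0 : p' *m B != 0.
  apply: contra_neq p'_neq0 => p'B0; have [w p'E] := submxP p'B.
  apply/eqP; rewrite p'E -mulmxC_eq0 trmxC_mul trmxCK mulmxA -p'E.
  by rewrite p'B0 mul0mx.
have [k k_gt0] := normalize_row p'_neq0; set p := k *: p' => p_unitary.
have pA : p *m A = a *: p by rewrite -scalemxAl p'A /p !scalerA mulrC.
have pB_neq0 : p *m B != 0 by rewrite -scalemxAl scaler_eq0 gt_eqF.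
have pS : p *m B *m B^t* = s *: p by rewrite -mulmxA -scalemxAl p'S /p !scalerA mulrC.
have [l l_gt0] := normalize_row pB_neq0; set q := l *: (p *m B) => q_unitary.
have pBE : p *m B = l^-1 *: q by rewrite scalerA mulVf ?scale1r ?gt_eqF.
(* The singular value is the norm [l^-1] of [p *m B]. The eigenvalue [a] serves twice, as
   [p B D = p A B = a p B]. *)
exists p, q, a, l^-1, a; split; first by rewrite invr_gt0.
have qBE : q *m B^t* = (l * s) *: p by rewrite -scalemxAl pS scalerA.
(* Both sides are the value of [q *m B^t* *m p^t*]: one through [q *m B^t*], the other through the
   adjoint of [p *m B]. *)
suff ls : l * s = l^-1.
  split=> //; last by rewrite qBE ls.
  by rewrite -scalemxAl -mulmxA -AB mulmxA pA /q -scalemxAl !scalerA mulrC.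
have : q *m B^t* *m p^t* = (l * s)%:M.
  by rewrite qBE -scalemxAl (unitarymxP p_unitary) scalemx1.
rewrite -mulmxA -trmxC_mul pBE trmxCZ -scalemxAr (unitarymxP q_unitary) scalemx1.
move/matrixP/(_ 0 0); rewrite !mxE eqxx !mulr1n => <-.
by apply/CrealP/gtr0_real; rewrite invr_gt0.
Qed.

Lemma unitary_col_mx m1 m2 n (p : 'M[C]_(m1, n)) (W : 'M[C]_(m2, n)) :
  p \is unitarymx -> W \is unitarymx -> W *m p^t* = 0 ->
  col_mx p W \is unitarymx.
Proof.
move=> pu Wu Wp; apply/unitarymxP; rewrite tr_col_mx map_row_mx mul_col_row.
have pW : p *m W^t* = 0 by rewrite -[p]trmxCK -trmxC_mul Wp trmx0 map_mx0.
by rewrite (unitarymxP pu) (unitarymxP Wu) Wp pW -scalar_mx_block.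
Qed.

Lemma col_mx_conj_diag m1 m2 n (A : 'M[C]_n) (p q : 'M_(m1, n))
    (W Z : 'M_(m2, n)) (x : 'rV_m1) (y : 'rV_m2) :
    p *m A *m q^t* = diag_mx x -> p *m A *m Z^t* = 0 ->
    W *m A *m q^t* = 0 -> W *m A *m Z^t* = diag_mx y ->
  col_mx p W *m A *m (col_mx q Z)^t* = diag_mx (row_mx x y).
Proof.
rewrite tr_col_mx map_row_mx mul_col_mx mul_col_row diag_mx_row.
by move=> -> -> -> ->.
Qed.

(* The non-zero entries of [b] come first, so that no permutation is needed when
   the non-real eigenvalues are collected at the top of the canonical form. *)
Definition diag_witness n (A B D : 'M[C]_n) : Prop :=
  exists P Q : 'M_n, exists a b d : 'rV_n, exists c : nat,
    [/\ P \is unitarymx, Q \is unitarymx, (c <= n)%N,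
        forall j, b 0 j \is Num.real
      & forall j, (b 0 j != 0) = (j < c)%N] /\
    [/\ P *m A *m P^t* = diag_mx a, P *m B *m Q^t* = diag_mx b
      & Q *m D *m Q^t* = diag_mx d].

(** Induction on [n]. If [B = 0], then [A] and [D] are diagonalized independently. Otherwise a
    singular pair is split off in front, and the induction hypothesis applies to the compressions to
    the orthogonal complements of [p] and [q]. *)
Lemma commuting_svd n (A B D : 'M[C]_n) :
  A^t* = A -> D^t* = D -> A *m B = B *m D -> diag_witness A B D.
Proof.
elim: n => [|n IHn] in A B D *; move=> A_herm D_herm AB.
  exists 1%:M, 1%:M, 0, 0, 0, 0%N; split.
    by split=> //; [apply/unitarymxP/matrixP => -[]..|case|case].
  by split; apply/matrixP => -[].
have [B0|B_neq0] := eqVneq B 0.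
  have [P [a [Pu PA]]] := hermitian_diagonalization A_herm.
  have [Q [d [Qu QD]]] := hermitian_diagonalization D_herm.
  exists P, Q, a, 0, d, 0%N; split.
    by split=> // j; rewrite mxE ?eqxx ?real0.
  by split=> //; rewrite B0 mulmx0 mul0mx; apply/matrixP=> i j; rewrite !mxE mul0rn.
have [p [q [a [b [d [[pu qu b_gt0] [pA qD pB qB]]]]]]] :=
  singular_pair A_herm D_herm AB B_neq0.
have [W Wu Wp] := unitarymx_complete_row pu.
have [Z Zu Zq] := unitarymx_complete_row qu.
have pW : p *m W^t* = 0 by rewrite -[p]trmxCK -trmxC_mul Wp trmx0 map_mx0.
have qZ : q *m Z^t* = 0 by rewrite -[q]trmxCK -trmxC_mul Zq trmx0 map_mx0.
have Pu := unitary_col_mx pu Wu Wp; have Qu := unitary_col_mx qu Zu Zq.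
have WAp : W *m A *m p^t* = 0.
  by rewrite -mulmxA -[A in LHS]A_herm -trmxC_mul pA trmxCZ -scalemxAr Wp scaler0.
have ZDq : Z *m D *m q^t* = 0.
  by rewrite -mulmxA -[D in LHS]D_herm -trmxC_mul qD trmxCZ -scalemxAr Zq scaler0.
have WBq : W *m B *m q^t* = 0.
  by rewrite -mulmxA -[B in LHS]trmxCK -trmxC_mul qB trmxCZ -scalemxAr Wp scaler0.
have [||| P [Q [a' [b' [d' [c [[P'u Q'u le_cn b'_real b'_neq0] [PA PB QD]]]]]]]] :=
  IHn (W *m A *m W^t*) (W *m B *m Z^t*) (Z *m D *m Z^t*).
- by rewrite !trmxC_mul trmxCK A_herm mulmxA.
- by rewrite !trmxC_mul trmxCK D_herm mulmxA.
(* The relation [A B = B D] passes to the compressions: the projections [W^t* *m W] and [Z^t* *m Z]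
   differ from the identity by terms that [WAp] and [WBq] annihilate. *)
- have splitW : W^t* *m W = 1%:M - p^t* *m p.
    have := mulmxKtV 1%:M Pu erefl; rewrite mul1mx tr_col_mx map_row_mx.
    by rewrite mul_row_col => <-; rewrite addrAC subrr add0r.
  have splitZ : Z^t* *m Z = 1%:M - q^t* *m q.
    have := mulmxKtV 1%:M Qu erefl; rewrite mul1mx tr_col_mx map_row_mx.
    by rewrite mul_row_col => <-; rewrite addrAC subrr add0r.
  rewrite !mulmxA -(mulmxA (W *m A)) -(mulmxA (W *m B)) splitW splitZ.
  rewrite !(mulmxBr, mulmxBl) !mulmxA WAp WBq !mul0mx !subr0 !mulmx1.
  by rewrite -(mulmxA W A) AB mulmxA.
exists (col_mx p (P *m W)), (col_mx q (Q *m Z)).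
exists (row_mx a%:M a'), (row_mx b%:M b'), (row_mx d%:M d'), c.+1.
have PWp : P *m W *m p^t* = 0 by rewrite -mulmxA Wp mulmx0.
have QZq : Q *m Z *m q^t* = 0 by rewrite -mulmxA Zq mulmx0.
split.
  split=> //.
  - exact: unitary_col_mx pu (mul_unitarymx P'u Wu) PWp.
  - exact: unitary_col_mx qu (mul_unitarymx Q'u Zu) QZq.
  - move=> j; rewrite mxE; case: splitP => k _ //.
    by rewrite ord1 mxE eqxx mulr1n gtr0_real.
  - move=> j; rewrite mxE; case: splitP => k /= ->; last by rewrite b'_neq0.
  by rewrite !ord1 mxE eqxx mulr1n gt_eqF.
have conjP (X : 'M[C]_n.+1) (P1 Q1 : 'M[C]_n) (W1 Z1 : 'M[C]_(n, n.+1)) :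
    P1 *m W1 *m X *m (Q1 *m Z1)^t* = P1 *m (W1 *m X *m Z1^t*) *m Q1^t*.
  by rewrite trmxC_mul !mulmxA.
have conjp (X : 'M[C]_n.+1) (q1 : 'rV[C]_n.+1) (P1 : 'M[C]_n) (W1 : 'M[C]_(n, n.+1)) :
    W1 *m X *m q1^t* = 0 -> P1 *m W1 *m X *m q1^t* = 0.
  by move=> WXq; rewrite -!mulmxA (mulmxA W1) WXq mulmx0.
split; apply: (@col_mx_conj_diag 1 n n.+1); rewrite ?conjP ?conjp // ?(pA, pB, qD);
  rewrite -scalemxAl ?trmxC_mul ?mulmxA ?(pW, qZ) ?mul0mx ?scaler0 //;
  rewrite (unitarymxP _) // scalemx1.
  all: by apply/matrixP=> i j; rewrite !ord1 !mxE !mulr1n.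
Qed.

End CommutingSVD.

(** * Entries of the flip matrix and the two halves of the index range *)

Lemma flipmxE (R : pzSemiRingType) m (i k : 'I_m) :
  flipmx R m i k = (k == rev_ord i)%:R.
Proof.
rewrite mxE; congr (nat_of_bool _)%:R; rewrite -val_eqE /=.
by have := ltn_ord i; have := ltn_ord k; lia.
Qed.

Lemma mul_flipmx (R : pzSemiRingType) m p (A : 'M[R]_(m, p)) i k :
  (flipmx R m *m A) i k = A (rev_ord i) k.
Proof.
rewrite mxE (bigD1 (rev_ord i)) //= flipmxE eqxx mul1r big1 ?addr0 // => j ne_j.
by rewrite flipmxE (negPf ne_j) mul0r.
Qed.

Lemma half_ind n (P : 'I_(2 * n) -> Prop) :
  (forall j, P (fst_half j)) -> (forall j, P (rev_ord (fst_half j))) ->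
  forall i, P i.
Proof.
move=> Pf Pr i; have [lt_in|le_ni] := ltnP i n.
  by have -> : i = fst_half (Ordinal lt_in) by apply: val_inj.
have lt_jn : (2 * n - i.+1 < n)%N by have := ltn_ord i; lia.
have -> // : i = rev_ord (fst_half (Ordinal lt_jn)).
by apply: val_inj => /=; have := ltn_ord i; lia.
Qed.

Lemma fst_half_inj n : injective (@fst_half n).
Proof. by move=> i j /(congr1 val) /= /val_inj. Qed.

Lemma rev_fst_half_neq n (i j : 'I_n) : (rev_ord (fst_half i) == fst_half j) = false.
Proof.
apply/negbTE; rewrite -val_eqE /=.
by have := ltn_ord i; have := ltn_ord j; lia.
Qed.

(** * Orthonormal bases adapted to the flip *)

Section Flip.
Variable C : numClosedFieldType.

Lemma flipmx_trC m : (flipmx C m)^t* = flipmx C m.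
Proof. by apply/matrixP=> i k; rewrite !mxE conjC_nat addnC. Qed.

Lemma mulmx_flip m p (A : 'M[C]_(p, m)) i k :
  (A *m flipmx C m) i k = A i (rev_ord k).
Proof.
rewrite -[A *m _]trmxCK trmxC_mul flipmx_trC mxE mxE mul_flipmx !mxE.
exact: conjCK.
Qed.

Lemma flipmxK m : flipmx C m *m flipmx C m = 1%:M.
Proof. by apply/matrixP=> i k; rewrite mul_flipmx flipmxE rev_ordK mxE eq_sym. Qed.

(** The flip is Hermitian and involutive, so the hypothesis becomes a formula for the adjoint of
    [M]. *)
Lemma perhermitian_trC m (M : 'M[C]_m) : perhermitian M ->
  M^t* = flipmx C m *m M *m flipmx C m.
Proof.
rewrite /perhermitian trmxC_mul flipmx_trC => <-.
by rewrite -mulmxA flipmxK mulmx1.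
Qed.

(** Selects the first [n] coordinates; [halfmx n *m F n] selects their mirror images. The two stand
    in for a block decomposition of size [n + n], without casts. *)
Definition halfmx n : 'M[C]_(n, 2 * n) := \matrix_(j, k) (k == fst_half j)%:R.

Lemma mul_halfmx n p (A : 'M[C]_(2 * n, p)) j k :
  (halfmx n *m A) j k = A (fst_half j) k.
Proof.
rewrite mxE (bigD1 (fst_half j)) //= mxE eqxx mul1r big1 ?addr0 // => i ne_i.
by rewrite mxE (negPf ne_i) mul0r.
Qed.

Lemma mulmx_half n p (A : 'M[C]_(p, 2 * n)) i j :
  (A *m (halfmx n)^t*) i j = A i (fst_half j).
Proof.
rewrite -[A *m _]trmxCK trmxC_mul trmxCK mxE mxE mul_halfmx !mxE.
exact: conjCK.
Qed.

Local Notation F n := (flipmx C (2 * n)).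

Lemma halfmx_unitary n : halfmx n \is unitarymx.
Proof.
apply/unitarymxP/matrixP=> i j; rewrite mulmx_half !mxE.
by rewrite (inj_eq (@fst_half_inj n)) eq_sym.
Qed.

Lemma halfmx_flip n : halfmx n *m F n *m (halfmx n)^t* = 0.
Proof.
apply/matrixP=> i j; rewrite mulmx_half mulmx_flip !mxE.
by rewrite rev_fst_half_neq.
Qed.

(** The two selectors stacked form a square matrix [T] with orthonormal rows, so that
    [T^t* *m T = 1] as well. *)
Lemma halfmx_complete n :
  (halfmx n)^t* *m halfmx n + F n *m (halfmx n)^t* *m halfmx n *m F n = 1%:M.
Proof.
set E := halfmx n.
have Tu : col_mx E (E *m F n) \is unitarymx.
  apply: unitary_col_mx; rewrite ?halfmx_unitary ?halfmx_flip //.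
  apply/unitarymxP; rewrite trmxC_mul flipmx_trC !mulmxA -(mulmxA E) flipmxK mulmx1.
  exact/unitarymxP/halfmx_unitary.
have := mulmxKtV 1%:M Tu; rewrite mul1mx tr_col_mx map_row_mx mul_row_col.
by rewrite trmxC_mul flipmx_trC !mulmxA => -> //; rewrite mul2n addnn.
Qed.

(* The rows of [X] and [Y] span the (+1)- and (-1)-eigenspaces of the flip. *)
Record flip_frame n (M : 'M[C]_(2 * n)) (X Y : 'M[C]_(n, 2 * n))
    (a b d : 'rV[C]_n) (c : nat) : Prop := FlipFrame {
  frame_XX : X *m X^t* = 1%:M;
  frame_YY : Y *m Y^t* = 1%:M;
  frame_XY : X *m Y^t* = 0;
  frame_YX : Y *m X^t* = 0;
  frame_XF : X *m F n = X;
  frame_YF : Y *m F n = - Y;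
  frame_XMX : X *m M *m X^t* = diag_mx a;
  frame_XMY : X *m M *m Y^t* = diag_mx b;
  frame_YMX : Y *m M *m X^t* = - diag_mx b;
  frame_YMY : Y *m M *m Y^t* = diag_mx d;
  frame_real : forall j,
    [/\ a 0 j \is Num.real, b 0 j \is Num.real & d 0 j \is Num.real];
  frame_le : (c <= n)%N;
  frame_b : forall j, (b 0 j != 0) = (j < c)%N;
  frame_ad : forall j : 'I_n, (j < c)%N -> a 0 j = d 0 j }.

Lemma diag_herm_real n (a : 'rV[C]_n) j :
  (diag_mx a)^t* = diag_mx a -> a 0 j \is Num.real.
Proof.
move/matrixP/(_ j j); rewrite !mxE eqxx !mulr1n => /CrealP.
exact.
Qed.

Lemma flip_frame_exists n (M : 'M[C]_(2 * n)) :
  M \is normalmx -> perhermitian M ->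
  exists X Y a b d c, flip_frame M X Y a b d c.
Proof.
move=> /normalmxP M_normal /perhermitian_trC M_trC.
pose s : C := (sqrtC 2)^-1.
have s_real : s^*%R = s by apply/CrealP; rewrite ger0_real ?invr_ge0 ?sqrtC_ge0 ?ler0n.
have ss : s * s = 2^-1 by rewrite -expr2 exprVn sqrtCK.
have half2 : (2^-1 + 2^-1 : C) = 1 by rewrite [RHS](splitr 1) mul1r.
set E := halfmx n; set G := F n in M_trC *.
have GK p (A : 'M[C]_(p, _)) : A *m G *m G = A by rewrite -mulmxA flipmxK mulmx1.
have EE : E *m E^t* = 1%:M := unitarymxP (halfmx_unitary n).
have EGE : E *m G *m E^t* = 0 := halfmx_flip n.
(* With [e_j] the standard basis and [j'] the mirror of [j], the rows are [(e_j + e_j') / sqrt 2]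
   and [(e_j - e_j') / sqrt 2]. *)
pose X := s *: (E + E *m G); pose Y := s *: (E - E *m G).
have XG : X *m G = X by rewrite -scalemxAl mulmxDl GK addrC.
have YG : Y *m G = - Y by rewrite -scalemxAl mulmxBl GK -scalerN opprB.
have GX : G *m X^t* = X^t* by rewrite -{2}XG trmxC_mul flipmx_trC.
have GY : G *m Y^t* = - Y^t* by rewrite -trmxCN -YG trmxC_mul flipmx_trC.
have XX : X *m X^t* = 1%:M.
  rewrite trmxCZ -scalemxAl -scalemxAr scalerA s_real ss trmxCD trmxC_mul flipmx_trC.
  rewrite !(mulmxDl, mulmxDr) !mulmxA GK EE EGE addr0 add0r.
  by rewrite scalerDr -scalerDl half2 scale1r.
have YY : Y *m Y^t* = 1%:M.
  rewrite trmxCZ -scalemxAl -scalemxAr scalerA s_real ss trmxCD trmxCN.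
  rewrite trmxC_mul flipmx_trC.
  rewrite !(mulmxDl, mulmxDr, mulmxN, mulNmx) !mulmxA GK EE EGE oppr0 addr0 add0r opprK.
  by rewrite scalerDr -scalerDl half2 scale1r.
have XY : X *m Y^t* = 0.
  rewrite trmxCZ -scalemxAl -scalemxAr scalerA s_real ss trmxCD trmxCN.
  rewrite trmxC_mul flipmx_trC.
  rewrite !(mulmxDl, mulmxDr, mulmxN, mulNmx) !mulmxA GK EE EGE oppr0 addr0 add0r.
  by rewrite subrr scaler0.
have YX : Y *m X^t* = 0 by rewrite -[Y]trmxCK -trmxC_mul XY trmx0 map_mx0.
have complete : X^t* *m X + Y^t* *m Y = 1%:M.
  have Tu : col_mx X Y \is unitarymx by apply: unitary_col_mx => //; apply/unitarymxP.
  have := mulmxKtV 1%:M Tu; rewrite mul1mx tr_col_mx map_row_mx mul_row_col.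
  by move=> -> //; rewrite mul2n addnn.
pose A := X *m M *m X^t*; pose B := X *m M *m Y^t*; pose D := Y *m M *m Y^t*.
have trX W : (X *m M *m W^t*)^t* = W *m G *m M *m X^t*.
  by rewrite !trmxC_mul trmxCK M_trC !mulmxA -!(mulmxA _ G) GX.
have trY W : (Y *m M *m W^t*)^t* = - (W *m G *m M *m Y^t*).
  by rewrite !trmxC_mul trmxCK M_trC !mulmxA -!(mulmxA _ G) GY mulmxN.
have A_herm : A^t* = A by rewrite trX XG.
have D_herm : D^t* = D by rewrite trY YG !mulNmx opprK.
have YMX : Y *m M *m X^t* = - B^t* by rewrite trX YG !mulNmx opprK.
(* Inserting [complete] between the factors shows that the mixed blocks of [M *m M^t*] and
   [M^t* *m M] are opposite, namely [B D - A B] and [A B - B D]. Normality makes them equal, so both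
   vanish. *)
have AB : A *m B = B *m D.
  have XhX : X *m M^t* *m X^t* = A.
    by rewrite M_trC !mulmxA XG -(mulmxA _ G) GX.
  have XhY : X *m M^t* *m Y^t* = - B.
    by rewrite M_trC !mulmxA XG -(mulmxA _ G) GY mulmxN.
  have YhY : Y *m M^t* *m Y^t* = D by rewrite -D_herm !trmxC_mul trmxCK mulmxA.
  have split1 (K L : 'M_(2 * n)) : X *m K *m L *m Y^t* =
      X *m K *m X^t* *m (X *m L *m Y^t*) + X *m K *m Y^t* *m (Y *m L *m Y^t*).
    rewrite -[X *m K in LHS]mulmx1 -complete mulmxDr !mulmxDl !mulmxA.
    by [].
  have e1 : X *m M *m M^t* *m Y^t* = B *m D - A *m B.
    by rewrite split1 XhY YhY mulmxN addrC.
  have e2 : X *m M^t* *m M *m Y^t* = A *m B - B *m D.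
    by rewrite split1 XhX XhY mulNmx.
  have : A *m B - B *m D = - (A *m B - B *m D).
    by rewrite opprB -e1 -e2 -!mulmxA (mulmxA M) M_normal !mulmxA.
  move/eqP; rewrite -subr_eq0 opprK -mulr2n -scaler_nat scaler_eq0 pnatr_eq0 /=.
  by rewrite subr_eq0 => /eqP.
have [P [Q [a [b [d [c [[Pu Qu le_cn b_real b_neq0] [PA PB QD]]]]]]]] :=
  commuting_svd A_herm D_herm AB.
have bC : (diag_mx b)^t* = diag_mx b.
  rewrite tr_diag_mx map_diag_mx; congr diag_mx; apply/rowP=> j.
  by rewrite mxE; apply/CrealP.
(* Left multiplication by [P] and [Q] changes the basis inside each eigenspace of the flip, so the
   flip relations survive. *)
exists (P *m X), (Q *m Y), a, b, d, c.
have conj4 (P1 Q1 : 'M[C]_n) (X1 Y1 : 'M[C]_(n, 2 * n)) :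
    P1 *m X1 *m M *m (Q1 *m Y1)^t* = P1 *m (X1 *m M *m Y1^t*) *m Q1^t*.
  by rewrite trmxC_mul !mulmxA.
have conj3 (P1 Q1 : 'M[C]_n) (X1 Y1 : 'M[C]_(n, 2 * n)) :
    P1 *m X1 *m (Q1 *m Y1)^t* = P1 *m (X1 *m Y1^t*) *m Q1^t*.
  by rewrite trmxC_mul !mulmxA.
have tr3 (P1 Q1 K : 'M[C]_n) : (P1 *m K *m Q1^t*)^t* = Q1 *m K^t* *m P1^t*.
  by rewrite !trmxC_mul trmxCK mulmxA.
split=> //; rewrite ?conj4 ?conj3 //.
- by rewrite XX mulmx1; apply/unitarymxP.
- by rewrite YY mulmx1; apply/unitarymxP.
- by rewrite XY mulmx0 mul0mx.
- by rewrite YX mulmx0 mul0mx.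
- by rewrite -mulmxA XG.
- by rewrite -mulmxA YG mulmxN.
- by rewrite YMX mulmxN mulNmx -bC -PB tr3.
- move=> j; split=> //; apply: diag_herm_real.
    by rewrite -PA tr3 A_herm.
  by rewrite -QD tr3 D_herm.
(* In the new bases [A B = B D] reads [a_j b_j = b_j d_j], where [b_j] cancels. *)
move=> j; rewrite -b_neq0 => bj_neq0; apply: (mulIf bj_neq0).
have : diag_mx a *m diag_mx b = diag_mx b *m diag_mx d.
  rewrite -PA -PB -QD; move: A B D AB {A_herm D_herm YMX PA PB QD} => A1 B1 D1 AB1.
  by rewrite !mulmxA !mulmxKtV // -(mulmxA P A1) AB1 !mulmxA.
rewrite !mulmx_diag => /matrixP /(_ j j); rewrite !mxE eqxx !mulr1n => ->.
exact: mulrC.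
Qed.

End Flip.

(** * Unitary matrices commuting with the flip *)

Section Assembly.
Variable C : numClosedFieldType.

Local Notation F n := (flipmx C (2 * n)).

(* The rows of [W] on top, followed by their images under the flip in reverse
   order: the conjugate transpose of the matrix sought by the theorem. *)
Definition symmetrize n (W : 'M[C]_(n, 2 * n)) : 'M[C]_(2 * n) :=
  (halfmx C n)^t* *m W + F n *m (halfmx C n)^t* *m W *m F n.

(** The flip exchanges the two summands. For a unitary matrix, this commutation amounts to being
    perplectic. *)
Lemma flip_symmetrize n (W : 'M[C]_(n, 2 * n)) :
  symmetrize W *m F n = F n *m symmetrize W.
Proof.
rewrite /symmetrize mulmxDl mulmxDr -[_ *m F n *m F n]mulmxA flipmxK mulmx1.
by rewrite !mulmxA flipmxK mul1mx addrC.
Qed.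

Lemma half_symmetrize n (W : 'M[C]_(n, 2 * n)) : halfmx C n *m symmetrize W = W.
Proof.
rewrite mulmxDr !mulmxA halfmx_flip !mul0mx addr0.
by rewrite (unitarymxP (halfmx_unitary C n)) mul1mx.
Qed.

(** The hypotheses give [symmetrize W *m W^t* = (halfmx C n)^t*]; commutation with the flip gives
    the mirrored half, and [halfmx_complete] adds the two. *)
Lemma symmetrize_unitary n (W : 'M[C]_(n, 2 * n)) :
  W *m W^t* = 1%:M -> W *m F n *m W^t* = 0 -> symmetrize W \is unitarymx.
Proof.
move=> WW WFW; apply/unitarymxP.
rewrite {2}/symmetrize trmxCD !trmxC_mul !trmxCK flipmx_trC mulmxDr.
have TW : symmetrize W *m W^t* = (halfmx C n)^t*.
  rewrite /symmetrize mulmxDl -!(mulmxA _ W) WW mulmx1.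
  by rewrite -!mulmxA (mulmxA W) WFW !mulmx0 addr0.
by rewrite !mulmxA flip_symmetrize -(mulmxA (F n)) TW halfmx_complete.
Qed.

Lemma half_matrixP n (A B : 'M[C]_(2 * n)) (E := halfmx C n) :
  (forall j k,
    [/\ (E *m A *m E^t*) j k = B (fst_half j) (fst_half k),
        (E *m A *m (E *m F n)^t*) j k = B (fst_half j) (rev_ord (fst_half k)),
        (E *m F n *m A *m E^t*) j k = B (rev_ord (fst_half j)) (fst_half k)
      & (E *m F n *m A *m (E *m F n)^t*) j k =
          B (rev_ord (fst_half j)) (rev_ord (fst_half k))]) -> A = B.
Proof.
move=> AB; apply/matrixP; apply: half_ind => j; apply: half_ind => k;
  have [] := AB j k; rewrite trmxC_mul flipmx_trC !mulmxA.
- by move=> <- _ _ _; rewrite mulmx_half mul_halfmx.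
- by move=> _ <- _ _; rewrite mulmx_half mulmx_flip mul_halfmx.
- by move=> _ _ <- _; rewrite mulmx_half -mulmxA mul_halfmx mul_flipmx.
- by move=> _ _ _ <-; rewrite mulmx_half mulmx_flip -mulmxA mul_halfmx mul_flipmx.
Qed.

(** The two selectors send [symmetrize W] to [W] and [W *m F n], so the four blocks of the conjugate
    involve these alone. *)
Lemma symmetrize_conjP n (W : 'M[C]_(n, 2 * n)) (M B : 'M[C]_(2 * n)) :
  (forall j k,
    [/\ (W *m M *m W^t*) j k = B (fst_half j) (fst_half k),
        (W *m M *m (W *m F n)^t*) j k = B (fst_half j) (rev_ord (fst_half k)),
        (W *m F n *m M *m W^t*) j k = B (rev_ord (fst_half j)) (fst_half k)
      & (W *m F n *m M *m (W *m F n)^t*) j k =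
          B (rev_ord (fst_half j)) (rev_ord (fst_half k))]) ->
  symmetrize W *m M *m (symmetrize W)^t* = B.
Proof.
move=> WMB; apply: half_matrixP => j k.
set T := symmetrize W; set E := halfmx C n.
have EF : E *m F n *m T = W *m F n.
  by rewrite -mulmxA -flip_symmetrize mulmxA half_symmetrize.
have conjT (K L : 'M[C]_(n, 2 * n)) :
    K *m (T *m M *m T^t*) *m L^t* = K *m T *m M *m (L *m T)^t*.
  by rewrite trmxC_mul !mulmxA.
by rewrite !conjT EF half_symmetrize.
Qed.

(** * The normal form of [M] on the invariant planes *)

Section Frame.
Variables (n : nat) (M : 'M[C]_(2 * n)) (X Y : 'M[C]_(n, 2 * n)).
Variables (a b d : 'rV[C]_n) (c : nat).
Hypothesis XY : flip_frame M X Y a b d c.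

(** Row [j] is [(x_j + z_j y_j) / sqrt 2], with [x_j] and [y_j] the rows of [X] and [Y]; the flip
    negates [z]. *)
Definition mix (z : 'rV[C]_n) := (sqrtC 2)^-1 *: (X + diag_mx z *m Y).

Lemma mix_flip z : mix z *m F n = mix (- z).
Proof.
rewrite -scalemxAl mulmxDl (frame_XF XY) -mulmxA (frame_YF XY).
by rewrite mulmxN /mix linearN mulNmx.
Qed.

(** All four compressions of [K] are diagonal, so distinct planes do not interact. The case [K = 1]
    gives Gram matrices, [K = M] the normal form. *)
Lemma mix_conj (K : 'M[C]_(2 * n)) (k11 k12 k21 k22 z w : 'rV[C]_n) :
  X *m K *m X^t* = diag_mx k11 -> X *m K *m Y^t* = diag_mx k12 ->
  Y *m K *m X^t* = diag_mx k21 -> Y *m K *m Y^t* = diag_mx k22 ->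
  mix z *m K *m (mix w)^t* =
  diag_mx (\row_j (2^-1 * (k11 0 j + k12 0 j * (w 0 j)^*%R
    + z 0 j * (k21 0 j + k22 0 j * (w 0 j)^*%R)))).
Proof.
move=> XX' XY' YX' YY'.
have s_real : ((sqrtC 2)^-1 : C)^*%R = (sqrtC 2)^-1.
  by apply/CrealP; rewrite ger0_real ?invr_ge0 ?sqrtC_ge0 ?ler0n.
rewrite trmxCZ s_real -!scalemxAl -scalemxAr scalerA -expr2 exprVn sqrtCK.
rewrite trmxCD trmxC_mul tr_diag_mx map_diag_mx mulmxDr !mulmxDl !mulmxA.
rewrite -!(mulmxA (diag_mx z)) !mulmxA -!(mulmxA (diag_mx z)).
rewrite XX' XY' YX' YY' !mulmx_diag; apply/matrixP => i j; rewrite !mxE.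
case: eqVneq => [->|_]; rewrite ?mulr1n ?mulr0n; first by ring.
by rewrite !addr0 mulr0.
Qed.

(** The value ['i] yields an eigenvector [x + 'i y] when [b_j != 0]; the value [1] yields the pair
    [x + y], [x - y] when [b_j = 0]. *)
Let z : 'rV[C]_n := \row_j (if (j < c)%N then 'i%R else 1).
Let W : 'M[C]_(n, 2 * n) := mix z.

(** For [j < c], the eigenvalue of [x + 'i y]. Otherwise [frame_diag] and [frame_cross] are the
    entries of the form [diag (a_j, d_j)] in the basis [(x + y) / sqrt 2], [(x - y) / sqrt 2]. *)
Definition frame_diag (j : 'I_n) := if (j < c)%N then a 0 j - 'i%R * b 0 j
                                  else 2^-1 * (a 0 j + d 0 j).
Definition frame_cross (j : 'I_n) := if (j < c)%N then 0
                                     else 2^-1 * (a 0 j - d 0 j).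

Lemma frame_b0 (j : 'I_n) : (c <= j)%N -> b 0 j = 0.
Proof. by rewrite leqNgt -(frame_b XY) negbK => /eqP. Qed.

Let zz j : z 0 j * (z 0 j)^*%R = 1.
Proof.
rewrite mxE; case: ifP => _; last by rewrite conjC1 mulr1.
by rewrite conjCi mulrN -expr2 sqrCi opprK.
Qed.

Let half2 : 2^-1 * (1 + 1) = 1 :> C.
Proof. by rewrite mulVf // pnatr_eq0. Qed.

Lemma mix_gram (u w : 'rV[C]_n) :
  mix u *m (mix w)^t* = diag_mx (\row_j (2^-1 * (1 + u 0 j * (w 0 j)^*%R))).
Proof.
rewrite -[mix u]mulmx1 (@mix_conj _ (const_mx 1) 0 0 (const_mx 1)) ?mulmx1.
- congr diag_mx; apply/rowP => j; rewrite !mxE.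
  by rewrite !mul0r addr0 add0r mul1r.
- by rewrite (frame_XX XY) diag_const_mx.
- by rewrite (frame_XY XY) linear0.
- by rewrite (frame_YX XY) linear0.
- by rewrite (frame_YY XY) diag_const_mx.
Qed.

Lemma mix_unitary : W *m W^t* = 1%:M.
Proof.
rewrite mix_gram -diag_const_mx; congr diag_mx; apply/rowP => j.
by rewrite [LHS]mxE zz half2 mxE.
Qed.

Lemma mix_flip_orthogonal : W *m F n *m W^t* = 0.
Proof.
rewrite mix_flip mix_gram -[RHS](linear0 (@diag_mx C n)).
congr diag_mx; apply/rowP => j.
by rewrite [LHS]mxE [(- z) 0 j]mxE mulNr zz subrr mulr0 mxE.
Qed.

Lemma mix_conjM (u w : 'rV[C]_n) : mix u *m M *m (mix w)^t* =
  diag_mx (\row_j (2^-1 * (a 0 j + b 0 j * (w 0 j)^*%R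
    + u 0 j * (- b 0 j + d 0 j * (w 0 j)^*%R)))).
Proof.
rewrite (@mix_conj _ a b (- b) d); last exact: frame_YMY XY.
- by congr diag_mx; apply/rowP => j; rewrite !mxE.
- exact: frame_XMX XY.
- exact: frame_XMY XY.
- by rewrite (frame_YMX XY) linearN.
Qed.

Lemma frame_normal_form j k :
  [/\ (W *m M *m W^t*) j k = frame_diag j *+ (j == k),
      (W *m M *m (W *m F n)^t*) j k = frame_cross j *+ (j == k),
      (W *m F n *m M *m W^t*) j k = frame_cross j *+ (j == k)
    & (W *m F n *m M *m (W *m F n)^t*) j k = (frame_diag j)^*%R *+ (j == k)].
Proof.
rewrite mix_flip !mix_conjM !mxE /frame_diag /frame_cross.
have [aR bR dR] := frame_real XY j.
have [lt_jc|le_cj] := ltnP j c.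
  have iC : ('i%R : C)^*%R = - 'i%R := conjCi C.
  have iNC : (- 'i%R : C)^*%R = 'i%R by rewrite raddfN /= iC opprK.
  have dC : (a 0 j - 'i%R * b 0 j)^*%R = a 0 j + 'i%R * b 0 j.
    by rewrite raddfB /= rmorphM /= iC !(CrealP _) // mulNr opprK.
  have ii : ('i%R : C) * 'i%R = - 1 by rewrite -expr2 sqrCi.
  (* With [d_j = a_j], all four entries follow from ['i * 'i = -1]. *)
  rewrite -(frame_ad XY lt_jc) dC iC iNC.
  split; congr (_ *+ _).
  - by field: ii.
  - by field: ii.
  - by field: ii.
  - by field: ii.
have N1C : (- 1 : C)^*%R = - 1 by rewrite raddfN /= conjC1.
have sC : (2^-1 * (a 0 j + d 0 j))^*%R = 2^-1 * (a 0 j + d 0 j).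
  by apply/CrealP; rewrite realM ?realD // realV realn.
rewrite frame_b0 // sC N1C conjC1.
by split; congr (_ *+ _); ring.
Qed.

End Frame.
End Assembly.

(** * Cross-shaped matrices *)

Section CrossMatrix.
Variables (R : pzSemiRingType) (r : nat).

Lemma half_of_proof (i : 'I_(2 * r)) : (minn i (2 * r - i.+1) < r)%N.
Proof. by have := ltn_ord i; lia. Qed.

(** Common index of [i] and its mirror image, which lets [a] and [b] be read from any row. *)
Definition half_of i : 'I_r := Ordinal (half_of_proof i).

Lemma half_of_fst j : half_of (fst_half j) = j.
Proof. by apply: val_inj => /=; have := ltn_ord j; lia. Qed.

Lemma half_of_rev i : half_of (rev_ord i) = half_of i.
Proof. by apply: val_inj => /=; have := ltn_ord i; lia. Qed.

Variables a b : 'I_r -> R.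

(** Generic in the entries, as it serves over both [R] and [R[i]]. The two tests never hold
    together, since the size is even. *)
Definition crossmx : 'M[R]_(2 * r) := \matrix_(i, k)
  if k == i then a (half_of i) else if k == rev_ord i then b (half_of i) else 0.

Lemma crossmx_sym : crossmx^T = crossmx.
Proof.
apply/matrixP => i k; rewrite !mxE eq_sym; case: eqVneq => [->//|_].
rewrite -(inj_eq rev_ord_inj) rev_ordK eq_sym; case: eqVneq => [->|//].
by rewrite half_of_rev.
Qed.

Lemma crossmx_rev i k : crossmx (rev_ord i) (rev_ord k) = crossmx i k.
Proof. by rewrite !mxE !(inj_eq rev_ord_inj) half_of_rev. Qed.

(** Follows from symmetry and invariance under reversing both indices. *)
Lemma crossmx_persymmetric : persymmetric crossmx.
Proof.
apply/matrixP => i k; rewrite mul_flipmx -[in RHS]crossmx_sym [RHS]mxE.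
by rewrite [LHS]mxE mul_flipmx -[RHS]crossmx_rev rev_ordK.
Qed.

Lemma crossmx_ff j k : crossmx (fst_half j) (fst_half k) = a j *+ (j == k).
Proof.
rewrite mxE (inj_eq (@fst_half_inj r)) half_of_fst.
rewrite [fst_half k == _]eq_sym rev_fst_half_neq eq_sym.
by case: eqVneq.
Qed.

Lemma crossmx_fr j k : crossmx (fst_half j) (rev_ord (fst_half k)) = b j *+ (j == k).
Proof.
rewrite mxE rev_fst_half_neq (inj_eq rev_ord_inj) (inj_eq (@fst_half_inj r)).
by rewrite half_of_fst eq_sym; case: eqVneq.
Qed.

Lemma crossmx_rf j k : crossmx (rev_ord (fst_half j)) (fst_half k) = b j *+ (j == k).
Proof. by rewrite -crossmx_rev rev_ordK crossmx_fr. Qed.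

Lemma crossmx_rr j k :
  crossmx (rev_ord (fst_half j)) (rev_ord (fst_half k)) = a j *+ (j == k).
Proof. by rewrite crossmx_rev crossmx_ff. Qed.

End CrossMatrix.

Lemma crossmxP (R : realType) r (a b : 'I_r -> R) : is_crossmx a b (crossmx a b).
Proof.
split=> [j|i k k_neq_i k_neq_r] /=.
  by split; rewrite ?crossmx_ff ?crossmx_rr ?crossmx_fr ?crossmx_rf eqxx.
by rewrite mxE (negPf k_neq_i) (negPf k_neq_r).
Qed.

(** For a unit eigenvector [u], the scalar [u *m K *m u^t*] equals [lam] and is its own
    conjugate. *)
Lemma hermitian_eigenvalue_real (C : numClosedFieldType) n (K : 'M[C]_n) lam :
  K^t* = K -> eigenvalue K lam -> lam \is Num.real.
Proof.
move=> K_herm /eigenvalueP[v vK v_neq0].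
have [k k_gt0 u_unitary] := normalize_row v_neq0.
set u := k *: v in u_unitary.
have uK : u *m K = lam *: u by rewrite -scalemxAl vK /u !scalerA mulrC.
have uKu : u *m K *m u^t* = lam%:M.
  by rewrite uK -scalemxAl (unitarymxP u_unitary) scalemx1.
have := congr1 (fun B : 'M_1 => (B^t*) 0 0) uKu.
rewrite !trmxC_mul trmxCK K_herm mulmxA uKu !mxE eqxx !mulr1n => /esym/CrealP.
exact.
Qed.

(** * Entries of the block-diagonal canonical form *)

Section Canonical.
Variables (C : numClosedFieldType) (c r : nat) (e : (c + r = c + r)%N).
Variables (D : 'M[C]_c) (X : 'M[C]_(2 * r)).

Local Notation cast := (cast_ord (esym (canon_dim e))).

(** These four identities locate the indices: the first half runs through [D] and the upper half of
    the cross block, its mirror through the lower half of the cross block and the last block. *)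
Lemma cast_fst_l (l : 'I_c) : cast (fst_half (lshift r l)) = lshift _ l.
Proof. exact: val_inj. Qed.

Lemma cast_fst_r (k : 'I_r) :
  cast (fst_half (rshift c k)) = rshift c (lshift c (fst_half k)).
Proof. exact: val_inj. Qed.

Lemma cast_rev_r (k : 'I_r) :
  cast (rev_ord (fst_half (rshift c k))) = rshift c (lshift c (rev_ord (fst_half k))).
Proof. by apply: val_inj => /=; have := ltn_ord k; lia. Qed.

Lemma cast_rev_l (l : 'I_c) :
  cast (rev_ord (fst_half (lshift r l))) = rshift c (rshift (2 * r) (rev_ord l)).
Proof. by apply: val_inj => /=; have := ltn_ord l; lia. Qed.

Lemma flip_conj_entry i k :
  (flipmx C c *m D^t* *m flipmx C c) (rev_ord i) (rev_ord k) = (D k i)^*%R.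
Proof. by rewrite mulmx_flip mul_flipmx !rev_ordK !mxE. Qed.

End Canonical.

(** The entries are listed in the shape produced by [frame_normal_form]. The block [D] needs
    vanishing cross terms, the cross block self-conjugate diagonal terms. *)
Lemma canonmx_entries (C : numClosedFieldType) (c r n : nat) (e : (c + r = n)%N)
    (dl cr : 'I_n -> C) (j k : 'I_n) :
    (forall l, cr (cast_ord e (lshift r l)) = 0) ->
    (forall i, (dl (cast_ord e (rshift c i)))^*%R = dl (cast_ord e (rshift c i))) ->
  let K := canonmx e (diag_mx (\row_l dl (cast_ord e (lshift r l))))
    (crossmx (fun i => dl (cast_ord e (rshift c i)))
             (fun i => cr (cast_ord e (rshift c i)))) in
  [/\ dl j *+ (j == k) = K (fst_half j) (fst_half k),
      cr j *+ (j == k) = K (fst_half j) (rev_ord (fst_half k)),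
      cr j *+ (j == k) = K (rev_ord (fst_half j)) (fst_half k)
    & (dl j)^*%R *+ (j == k) = K (rev_ord (fst_half j)) (rev_ord (fst_half k))].
Proof.
(* Replacing [n] by [c + r] turns every [cast_ord e] into the identity. *)
case: n / e (e) dl cr j k => e dl cr j k.
have castE i : cast_ord e i = i by apply: val_inj.
move=> cr0 dlC /=; rewrite !castmxE.
have {}cr0 l : cr (lshift r l) = 0 by have := cr0 l; rewrite castE.
have {}dlC i : (dl (rshift c i))^*%R = dl (rshift c i) by have := dlC i; rewrite castE.
case: (split_ordP j) => {}j ->; case: (split_ordP k) => {}k ->;
  rewrite !(cast_fst_l, cast_fst_r, cast_rev_r, cast_rev_l);
  rewrite !(block_mxEul, block_mxEur, block_mxEdl, block_mxEdr) ?flip_conj_entry;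
  rewrite ?(crossmx_ff, crossmx_fr, crossmx_rf, crossmx_rr, castE, dlC);
  rewrite ?(eq_lshift, eq_rshift, eq_lrshift, eq_rlshift) ?mulr0n ?cr0 ?mul0rn.
- split=> //; rewrite !mxE ?castE //.
  by rewrite eq_sym; case: eqVneq => [->|_]; rewrite ?mulr1n ?mulr0n ?conjC0.
- by split; rewrite ?mxE.
- by split; rewrite ?mxE.
- by split.
Qed.

Theorem theorem3p1 (R : realType) (n : nat) (n_ge1 : (1 <= n)%N)
    (M : 'M[R[i]]_(2 * n)) (M_normal : M \is normalmx)
    (M_perherm : perhermitian M) :
  exists U : 'M[R[i]]_(2 * n), U \is unitarymx /\ perplectic U /\
  exists (c r : nat) (e : (c + r = n)%N) (D : 'M[R[i]]_c) (X : 'M[R]_(2 * r))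
         (a b : 'I_r -> R),
    is_diag_mx D /\
    (forall k : 'I_c, complex.Im (D k k) != 0) /\
    U^t* *m M *m U = canonmx e D (complexmx X) /\
    perhermitian (canonmx e D (complexmx X)) /\
    is_crossmx a b X /\
    X^T = X /\
    persymmetric X /\
    (forall lam : R[i], eigenvalue (complexmx X) lam -> complex.Im lam = 0).
Proof.
have [V [Y [a [b [d [c fr]]]]]] := flip_frame_exists M_normal M_perherm.
have real_Im (x : R[i]) : x \is Num.real -> complex.Im x = 0.
  by move=> /RIm_real [].
pose W := mix V Y (\row_j (if (j < c)%N then 'i%R else 1)).
pose T := symmetrize W.
have T_unitary : T \is unitarymx.
  by apply: symmetrize_unitary; [apply: mix_unitary fr|apply: mix_flip_orthogonal fr].
(* The rows of [T] are the new basis vectors, so [U] is the adjoint of [T]. *)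
exists (T^t*); split; first by rewrite trmxC_unitary.
have TF := flip_symmetrize W; rewrite -/T in TF.
split.
  by rewrite /perplectic trmxCK TF -mulmxA (unitarymxP T_unitary) mulmx1.
rewrite trmxCK; have le_cn := frame_le fr.
pose r := (n - c)%N; have e : (c + r = n)%N by rewrite subnKC.
pose toR k : 'I_n := cast_ord e (rshift c k).
(* These entries are real elements of [R[i]]; taking real parts brings them down to [R]. *)
pose al k := complex.Re (frame_diag a b d c (toR k)).
pose be k := complex.Re (frame_cross a d c (toR k)).
pose D : 'M[R[i]]_c := diag_mx (\row_l frame_diag a b d c (cast_ord e (lshift r l))).
have diag_real i : frame_diag a b d c (toR i) \is Num.real.
  have [aR _ dR] := frame_real fr (toR i).
  by rewrite /frame_diag /= ltnNge leq_addr /= realM ?realD // realV realn.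
have cross_real i : frame_cross a d c (toR i) \is Num.real.
  have [aR _ dR] := frame_real fr (toR i).
  by rewrite /frame_cross /= ltnNge leq_addr /= realM ?realB // realV realn.
have TMT : T *m M *m T^t* = canonmx e D (complexmx (crossmx al be)).
  have -> : complexmx (crossmx al be) =
      crossmx (fun i => frame_diag a b d c (toR i))
              (fun i => frame_cross a d c (toR i)).
    apply/matrixP => i k; rewrite !mxE.
    case: ifP => _; first by rewrite /= RRe_real ?diag_real.
    by case: ifP => _; rewrite /= ?RRe_real ?cross_real.
  apply: symmetrize_conjP => j k.
  have [-> -> -> ->] := frame_normal_form fr j k.
  apply: canonmx_entries => [l|i]; first by rewrite /frame_cross /= ltn_ord.
  exact/CrealP/diag_real.
exists c, r, e, D, (crossmx al be), al, be.
split; first exact: diag_mx_is_diag.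
split.
  (* The imaginary part of [a_j - 'i b_j] is [- b_j], nonzero because [j < c]. *)
  move=> l; rewrite !mxE eqxx mulr1n /frame_diag /= ltn_ord.
  set j := cast_ord _ _; have [aR bR _] := frame_real fr j.
  have : b 0 j != 0 by rewrite (frame_b fr) /=.
  apply: contra_neq; rewrite -(RRe_real aR) -(RRe_real bR) /=.
  rewrite ?(mul0r, mul1r, mulr0, mulr1, addr0, add0r, subr0, sub0r).
  by move/eqP; rewrite oppr_eq0 => /eqP ->.
split; first exact: TMT.
split.
  (* Conjugation by [T], which commutes with the flip, preserves being per-Hermitian. *)
  set G := flipmx _ _ in TF.
  have FTh : G *m T^t* = T^t* *m G.
    by rewrite -[G in LHS]flipmx_trC -trmxC_mul TF trmxC_mul flipmx_trC.
  rewrite -TMT /perhermitian -/G !trmxC_mul trmxCK flipmx_trC.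
  rewrite (perhermitian_trC M_perherm) -/G -!mulmxA -FTh (mulmxA G G).
  by rewrite flipmxK mul1mx !mulmxA TF.
split; first exact: crossmxP.
split; first exact: crossmx_sym.
split; first exact: crossmx_persymmetric.
(* A real symmetric matrix is Hermitian over [R[i]]. *)
move=> lam; move/(hermitian_eigenvalue_real _) => lam_real; apply/real_Im/lam_real.
have := crossmx_sym al be; move: (crossmx al be) => X X_sym.
by rewrite -[in RHS]X_sym; apply/matrixP => i k; rewrite !mxE; apply: conjc_real.
Qed.
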